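(* Let $\lambda > 0$, let $T \in (0,\infty]$ and set $S = \frac{1-e^{-2\lambda T}}{2\lambda}$ (with $S = \frac{1}{2\lambda}$ if $T=\infty$). Let $u$ be a real-valued function on $[0,S)\times\mathbb{R}$ and $v$ a real-valued function on $[0,T)\times\mathbb{R}$, sufficiently smooth for all derivatives in the equations below to exist in the classical sense, and suppose that they are related by $$v(t,x) = e^{-\lambda t}\, u\!\left(\frac{1-e^{-2\lambda t}}{2\lambda}, x\right), \qquad t\in[0,T),\; x\in\mathbb{R}.$$ Then $v$ satisfies the weakly dissipative Novikov equation $$v_t - v_{txx} + 4 v^2 v_x - 3 v v_x v_{xx} - v^2 v_{xxx} + \lambda (v - v_{xx}) = 0, \qquad x \in \mathbb{R},\; 0<t<T,$$ if and only if $u$ satisfies the Novikov equation $$u_t - u_{txx} + 4 u^2 u_x - 3 u u_x u_{xx} - u^2 u_{xxx} = 0, \qquad x\in\mathbb{R},\; 0<t<S.$$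
   Context: Subscripts $t$ and $x$ denote partial derivatives. The map $t\mapsto \frac{1-e^{-2\lambda t}}{2\lambda}$ is a bijection from $[0,T)$ onto $[0,S)$. *)

(* Defs.v *)
From Stdlib Require Import Reals.
From Coquelicot Require Import Coquelicot.
Open Scope R_scope.

(* A function on [0,U) x R is a total function w : R -> R -> R, time first,
   whose values at times outside [0,U) are irrelevant: every condition below is
   imposed only at times 0 < t < U, and derivatives there are local. *)

Definition dt (w : R -> R -> R) : R -> R -> R :=
  fun t x => Derive (fun s => w s x) t.

Definition dx (w : R -> R -> R) : R -> R -> R :=
  fun t x => Derive (w t) x.

(* [Derive] is total, so existence is required separately: here of
   w_t, w_tx, w_txx, w_x, w_xx, w_xxx on (0,U) x R, with subscripts read from
   left to right (w_txx is w differentiated first in t, then twice in x). *)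
Definition classically_differentiable (U : Rbar) (w : R -> R -> R) : Prop :=
  forall t x : R, 0 < t -> Rbar_lt t U ->
    ex_derive (fun s => w s x) t /\
    ex_derive (dt w t) x /\
    ex_derive (dx (dt w) t) x /\
    ex_derive (w t) x /\
    ex_derive (dx w t) x /\
    ex_derive (dx (dx w) t) x.

Definition novikov (U : Rbar) (u : R -> R -> R) : Prop :=
  forall t x : R, 0 < t -> Rbar_lt t U ->
    dt u t x - dx (dx (dt u)) t x
    + 4 * (u t x) ^ 2 * dx u t x
    - 3 * u t x * dx u t x * dx (dx u) t x
    - (u t x) ^ 2 * dx (dx (dx u)) t x = 0.

Definition weakly_dissipative_novikov
    (lambda : R) (U : Rbar) (v : R -> R -> R) : Prop :=
  forall t x : R, 0 < t -> Rbar_lt t U ->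
    dt v t x - dx (dx (dt v)) t x
    + 4 * (v t x) ^ 2 * dx v t x
    - 3 * v t x * dx v t x * dx (dx v) t x
    - (v t x) ^ 2 * dx (dx (dx v)) t x
    + lambda * (v t x - dx (dx v) t x) = 0.

Definition time_change (lambda t : R) : R :=
  (1 - exp (- 2 * lambda * t)) / (2 * lambda).

(* The value at [m_infty] is junk: it is only used for T in (0,+oo]. *)
Definition final_time (lambda : R) (T : Rbar) : R :=
  match T with
  | Finite t => time_change lambda t
  | p_infty => 1 / (2 * lambda)
  | m_infty => 0
  end.

(* Main.v *)
Require Import Defs.
From Stdlib Require Import Reals Lra.
From Coquelicot Require Import Coquelicot.
Open Scope R_scope.

(** Write [a = exp (- lambda * t)] and [s = time_change lambda t], so that
    [v t = a u(s)] and [ds/dt = a^2].  The chain rule gives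
    [v_t = a^3 u_s - lambda a u]: the damping term [lambda v] cancels exactly the
    contribution of the prefactor, and the same cancellation survives [d^2/dx^2].
    Hence [(v_t - v_txx) + lambda (v - v_xx) = a^3 (u_s - u_sxx)].  The remaining
    terms of the equation are cubic in [u] and contain no time derivative, so
    they also scale by [a^3].  The left-hand side of the dissipative equation at
    [(t, x)] is therefore [a^3] times that of the Novikov equation at [(s, x)]
    ([dissipative_residual_rescaled]).  Since [a <> 0] and [time_change lambda]
    maps [(0, T)] onto [(0, final_time lambda T)], one vanishes everywhere exactly
    when the other does. *)

Definition novikov_residual (u : R -> R -> R) (t x : R) : R :=
  dt u t x - dx (dx (dt u)) t x
  + 4 * (u t x) ^ 2 * dx u t x
  - 3 * u t x * dx u t x * dx (dx u) t x
  - (u t x) ^ 2 * dx (dx (dx u)) t x.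

Lemma time_change_increasing (lambda t t' : R) :
  0 < lambda -> t < t' -> time_change lambda t < time_change lambda t'.
Proof.
intros hl htt'; unfold time_change, Rdiv.
apply Rmult_lt_compat_r; [apply Rinv_0_lt_compat; lra|].
assert (exp (- 2 * lambda * t') < exp (- 2 * lambda * t)); [|lra].
apply exp_increasing.
assert (0 < lambda * (t' - t)) by (apply Rmult_lt_0_compat; lra).
lra.
Qed.

Lemma time_change_0 (lambda : R) : time_change lambda 0 = 0.
Proof.
unfold time_change; rewrite Rmult_0_r, exp_0; unfold Rdiv; ring.
Qed.

Lemma time_change_lt_sup (lambda t : R) :
  0 < lambda -> time_change lambda t < 1 / (2 * lambda).
Proof.
intros hl; unfold time_change, Rdiv.
apply Rmult_lt_compat_r; [apply Rinv_0_lt_compat; lra|].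
assert (h := exp_pos (- 2 * lambda * t)); lra.
Qed.

Lemma time_change_lt_final_time (lambda t : R) (T : Rbar) :
  0 < lambda -> Rbar_lt t T -> time_change lambda t < final_time lambda T.
Proof.
intros hl; destruct T as [T| |]; simpl; intros ht.
- now apply time_change_increasing.
- now apply time_change_lt_sup.
- contradiction.
Qed.

Lemma time_change_pos (lambda t : R) :
  0 < lambda -> 0 < t -> 0 < time_change lambda t.
Proof.
intros hl ht; rewrite <- (time_change_0 lambda).
now apply time_change_increasing.
Qed.

Lemma time_change_surjective (lambda s : R) (T : Rbar) :
  0 < lambda -> Rbar_lt 0 T -> 0 < s -> s < final_time lambda T ->
  exists t : R, 0 < t /\ Rbar_lt t T /\ time_change lambda t = s.
Proof.
intros hl hT hs hsT.
assert (hsup : s < 1 / (2 * lambda)).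
{ destruct T as [T| |]; simpl in hT, hsT; try contradiction; trivial.
  assert (h := time_change_lt_sup lambda T hl); lra. }
assert (hlog : 0 < 1 - 2 * lambda * s).
{ apply (Rmult_lt_compat_l (2 * lambda)) in hsup; [|lra].
  replace (2 * lambda * (1 / (2 * lambda))) with 1 in hsup by (field; lra).
  lra. }
set (t := - ln (1 - 2 * lambda * s) / (2 * lambda)).
assert (hts : time_change lambda t = s).
{ unfold time_change, t.
  replace (- 2 * lambda * (- ln (1 - 2 * lambda * s) / (2 * lambda)))
    with (ln (1 - 2 * lambda * s)) by (field; lra).
  rewrite exp_ln by trivial; field; lra. }
(* Monotonicity of the time change recovers the bounds on [t] from those on [s]. *)
assert (hreflect : forall t', s < time_change lambda t' -> t < t').
{ intros t' h; apply Rnot_le_lt; intros [hlt | heq].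
  - apply (time_change_increasing lambda) in hlt; lra.
  - subst t'; lra. }
exists t; repeat split; trivial.
- apply Rnot_le_lt; intros [hlt | heq].
  + apply (time_change_increasing lambda) in hlt; trivial.
    rewrite time_change_0 in hlt; lra.
  + rewrite heq, time_change_0 in hts; lra.
- destruct T as [T| |]; simpl in *; trivial; now apply hreflect.
Qed.

Lemma is_derive_time_change (lambda t : R) :
  0 < lambda ->
  is_derive (time_change lambda) t (exp (- lambda * t) ^ 2).
Proof.
intros hl; unfold time_change; auto_derive; trivial.
replace (exp (- lambda * t) ^ 2) with (exp (- 2 * lambda * t)).
- field; lra.
- simpl; rewrite Rmult_1_r, <- exp_plus; f_equal; ring.
Qed.

Lemma locally_pos_Rbar_lt (t : R) (T : Rbar) :
  0 < t -> Rbar_lt t T -> locally t (fun r => 0 <= r /\ Rbar_lt r T).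
Proof.
intros ht htT; apply filter_and.
- apply (filter_imp (fun r => 0 < r)); [intros r; lra|].
  now apply open_gt.
- destruct T as [T| |]; simpl in *; try contradiction.
  + now apply open_lt.
  + now apply filter_forall.
Qed.

(** The relation between [f] and [g] is only required near [t]; the factor
    [a^2] of the time change turns the amplitude [a] of [g_s] into [a^3]. *)
Lemma Derive_rescaled (lambda t : R) (f g : R -> R) :
  0 < lambda ->
  locally t (fun r => f r = exp (- lambda * r) * g (time_change lambda r)) ->
  ex_derive g (time_change lambda t) ->
  Derive f t = exp (- lambda * t) ^ 3 * Derive g (time_change lambda t)
               + - lambda * exp (- lambda * t) * g (time_change lambda t).
Proof.
intros hl hloc hg.
rewrite (Derive_ext_loc _ _ _ hloc).
apply is_derive_unique.
assert (hcomp : is_derive (fun r => g (time_change lambda r)) t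
          (exp (- lambda * t) ^ 2 * Derive g (time_change lambda t))).
{ apply (is_derive_comp g (time_change lambda)).
  - now apply Derive_correct.
  - now apply is_derive_time_change. }
assert (hexp : is_derive (fun r => exp (- lambda * r)) t
                 (- lambda * exp (- lambda * t))).
{ auto_derive; trivial; ring. }
evar_last; [apply (is_derive_mult _ _ _ _ _ hexp hcomp Rmult_comm)|].
unfold plus, mult; simpl; ring.
Qed.

Lemma dx_scal (v u : R -> R -> R) (a t s : R) :
  (forall x, v t x = a * u s x) -> forall x, dx v t x = a * dx u s x.
Proof.
intros h x; unfold dx.
rewrite (Derive_ext _ _ _ h); apply Derive_scal.
Qed.

Lemma dx_lin_comb (w f g : R -> R -> R) (a b t s : R) :
  (forall x, ex_derive (f s) x) -> (forall x, ex_derive (g s) x) ->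
  (forall x, w t x = a * f s x + b * g s x) ->
  forall x, dx w t x = a * dx f s x + b * dx g s x.
Proof.
intros hf hg h x; unfold dx.
rewrite (Derive_ext _ _ _ h), Derive_plus, !Derive_scal; trivial;
  now apply ex_derive_scal.
Qed.

(** The damping term absorbs the part of [v_t] that comes from differentiating
    the amplitude, and everything left is homogeneous of degree three in it. *)
Lemma dissipative_residual_rescaled
    (lambda : R) (T : Rbar) (u v : R -> R -> R) (t x : R) :
  0 < lambda ->
  classically_differentiable (final_time lambda T) u ->
  (forall t x : R, 0 <= t -> Rbar_lt t T ->
     v t x = exp (- lambda * t) * u (time_change lambda t) x) ->
  0 < t -> Rbar_lt t T ->
  novikov_residual v t x + lambda * (v t x - dx (dx v) t x)
  = exp (- lambda * t) ^ 3 * novikov_residual u (time_change lambda t) x.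
Proof.
intros hl hu huv ht htT.
assert (hus := fun y => hu (time_change lambda t) y (time_change_pos _ _ hl ht)
                 (time_change_lt_final_time _ _ _ hl htT)).
assert (hv0 : forall y, v t y = exp (- lambda * t) * u (time_change lambda t) y).
{ intros y; apply huv; trivial; lra. }
assert (hv1 := dx_scal _ _ _ _ _ hv0).
assert (hv2 := dx_scal _ _ _ _ _ hv1).
assert (hv3 := dx_scal _ _ _ _ _ hv2).
assert (hvt : forall y, dt v t y =
   exp (- lambda * t) ^ 3 * dt u (time_change lambda t) y
   + - lambda * exp (- lambda * t) * u (time_change lambda t) y).
{ intros y; unfold dt.
  apply (Derive_rescaled lambda t (fun r => v r y) (fun r => u r y)); trivial.
  - apply (filter_imp (fun r => 0 <= r /\ Rbar_lt r T)).
    + intros r [hr hrT]; now apply huv.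
    + now apply locally_pos_Rbar_lt.
  - now apply (hus y). }
assert (hvtx := dx_lin_comb _ _ _ _ _ _ _
   (fun y => proj1 (proj2 (hus y)))
   (fun y => proj1 (proj2 (proj2 (proj2 (hus y))))) hvt).
assert (hvtxx := dx_lin_comb _ _ _ _ _ _ _
   (fun y => proj1 (proj2 (proj2 (hus y))))
   (fun y => proj1 (proj2 (proj2 (proj2 (proj2 (hus y)))))) hvtx).
unfold novikov_residual.
rewrite hvt, hvtxx, hv3, hv2, hv1, hv0; ring.
Qed.

Theorem theorem2p3 (lambda : R) (T : Rbar) (u v : R -> R -> R)
    (hlambda : 0 < lambda) (hT : Rbar_lt 0 T)
    (hu : classically_differentiable (final_time lambda T) u)
    (hv : classically_differentiable T v)
    (huv : forall t x : R, 0 <= t -> Rbar_lt t T ->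
       v t x = exp (- lambda * t) * u (time_change lambda t) x) :
  weakly_dissipative_novikov lambda T v <-> novikov (final_time lambda T) u.
Proof.
assert (hres := fun t x => dissipative_residual_rescaled
                  lambda T u v t x hlambda hu huv).
split.
- intros hv_eq s x hs hsS.
  destruct (time_change_surjective lambda s T hlambda hT hs hsS)
    as [t [ht [htT <-]]].
  specialize (hres t x ht htT).
  assert (hz := hv_eq t x ht htT).
  fold (novikov_residual v t x) in hz; rewrite hz in hres.
  symmetry in hres; apply Rmult_integral in hres.
  destruct hres as [hexp | hu0]; [exfalso | exact hu0].
  exact (pow_nonzero _ 3 (Rgt_not_eq _ _ (exp_pos (- lambda * t))) hexp).
- intros hu_eq t x ht htT.
  fold (novikov_residual v t x); rewrite hres by trivial.
  assert (hz := hu_eq (time_change lambda t) x (time_change_pos _ _ hlambda ht)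
                  (time_change_lt_final_time _ _ _ hlambda htT)).
  fold (novikov_residual u (time_change lambda t) x) in hz.
  rewrite hz; ring.
Qed.
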